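(* Let $M$ be an $n$-dimensional smooth manifold with $n\geq 2$ and let $F=\sqrt[m]{A}$ be an $m$-th root Finsler metric on $M$. Suppose that $F$ has isotropic $\mathbf{H}$-curvature, i.e. there is a $1$-form $\theta=\theta_i(x)y^i$ on $M$ such that $H_{ij}=\frac{n+1}{2F}\,\theta\,h_{ij}$ on $TM_0$. Then $\mathbf{H}=0$, i.e. $H_{ij}=0$ on $TM_0$.
   Context: $M$ is a $C^\infty$ manifold, $TM_0=TM\setminus\{0\}$ is the slit tangent bundle, and $(x^i,y^i)$ are standard local coordinates on $TM$. Repeated indices are summed. A $1$-form $\theta$ on $M$ is regarded as the function $\theta(x,y)=\theta_i(x)y^i$ on $TM$. A Finsler metric on $M$ is a function $F:TM\to[0,\infty)$ that is $C^\infty$ on $TM_0$, positively homogeneous of degree $1$ in $y$, and such that $g_{ij}(x,y)=\frac12\frac{\partial^2 F^2}{\partial y^i\partial y^j}$ is positive definite on $TM_0$; $(g^{ij})$ denotes the inverse matrix and $y_i=g_{ij}y^j$. An $m$-th root Finsler metric ($m$ a positive integer) is a Finsler metric of the form $F=\sqrt[m]{A}$ where, in local coordinates, $A=a_{i_1\dots i_m}(x)\,y^{i_1}\cdots y^{i_m}$ with $a_{i_1\dots i_m}$ symmetric in all its indices (so $A$ is a homogeneous polynomial of degree $m$ in $y$). Standing assumption: the matrix $A_{ij}=\frac{\partial^2A}{\partial y^i\partial y^j}$ is positive definite on $TM_0$. Angular metric: $h_{ij}=g_{ij}-F^{-2}y_iy_j$. Spray coefficients: $G^i=\frac14 g^{ik}\left\{2\frac{\partial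 g_{pk}}{\partial x^q}-\frac{\partial g_{pq}}{\partial x^k}\right\}y^py^q$; geodesics satisfy $\frac{d^2x^i}{dt^2}+2G^i(x,\frac{dx}{dt})=0$. Mean Berwald curvature: $E_{ij}=\frac12\,\frac{\partial^3 G^k}{\partial y^i\partial y^j\partial y^k}$ (half the trace of the Berwald curvature $\frac{\partial^3G^l}{\partial y^i\partial y^j\partial y^k}$). $\mathbf{H}$-curvature: the covariant horizontal derivative of $\mathbf{E}$ along geodesics, $H_{ij}=E_{ij|k}y^k$, explicitly $$H_{ij}=y^k\frac{\partial E_{ij}}{\partial x^k}-2G^k\frac{\partial E_{ij}}{\partial y^k}-\frac{\partial G^k}{\partial y^i}E_{kj}-\frac{\partial G^k}{\partial y^j}E_{ik}.$$ *)

(* Defs.v *)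
From HB Require Import structures.
From mathcomp Require Import all_boot all_order all_algebra all_fingroup.
From mathcomp Require Import all_classical all_reals all_analysis.
Set Implicit Arguments.
Unset Strict Implicit.
Unset Printing Implicit Defensive.
Import Order.TTheory GRing.Theory Num.Theory.
Import numFieldNormedType.Exports.
Local Open Scope classical_set_scope.
Local Open Scope ring_scope.

Section Smooth.
Context {R : realType} {V W : normedModType R}.

Fixpoint iter_derive (vs : seq V) (f : V -> W) : V -> W :=
  if vs is v :: vs' then fun x => 'D_v (iter_derive vs' f) x else f.

(* C^oo: all iterated directional derivatives are Frechet differentiable, in
   particular continuous. *)
Definition smooth_on (O : set V) (f : V -> W) : Prop :=
  forall (vs : seq V) (x : V), O x -> differentiable (iter_derive vs f) x.

Lemma derive_comp_diff {U : normedModType R} (f : U -> V) (g : V -> W) x v :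
    differentiable f x -> differentiable g (f x) ->
  'D_v (g \o f) x = 'D_('D_v f x) g (f x).
Proof.
move=> df dg; rewrite (deriveE _ df) (deriveE _ dg) deriveE; last first.
  exact: differentiable_comp.
by rewrite diff_comp.
Qed.

End Smooth.

(* [cmap] and [cinv] are total functions; they are only meaningful on [cdom]
   and on its image respectively. *)
Record coord_chart (R : realType) (X : topologicalType) (n : nat) :=
  CoordChart {
  cdom : set X ;
  cmap : X -> 'rV[R]_n ;
  cinv : 'rV[R]_n -> X ;
  cdom_open : open cdom ;
  cimg_open : open (cmap @` cdom) ;
  cmapK : forall p, cdom p -> cinv (cmap p) = p ;
  cmap_continuous : {within cdom, continuous cmap} ;
  cinv_continuous : {within cmap @` cdom, continuous cinv} }.

(* The atlas is not required to be maximal. *)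
Record manifold (R : realType) (n : nat) := Manifold {
  carrier :> topologicalType ;
  carrier_hausdorff : hausdorff_space carrier ;
  carrier_second_countable : @second_countable carrier ;
  atlas : Type ;
  chart : atlas -> coord_chart R carrier n ;
  chart_cover : forall p : carrier, exists c, cdom (chart c) p ;
  chart_compat : forall c c',
    smooth_on (cmap (chart c) @` (cdom (chart c) `&` cdom (chart c')))
              (cmap (chart c') \o cinv (chart c)) }.

Section TangentBundle.
Context {R : realType} {n : nat} (M : manifold R n).
Implicit Types (c d e : atlas M) (p : M).

Definition dom c : set M := cdom (chart c).
Definition phi c : M -> 'rV[R]_n := cmap (chart c).
Definition phi_inv c : 'rV[R]_n -> M := cinv (chart c).
Definition codom_chart c : set 'rV[R]_n := phi c @` dom c.
Definition transition c d : 'rV[R]_n -> 'rV[R]_n := phi d \o phi_inv c.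

(* A tangent vector is a base point together with the components
   (y^1, ..., y^n) in each chart around that point, transforming by the
   Jacobian of the change of coordinates.  In charts that do not contain the
   base point the components are normalised to 0, so that equality of tangent
   vectors is Leibniz equality. *)
Record tangent_bundle := TangentVector {
  base : M ;
  comp : atlas M -> 'rV[R]_n ;
  comp_out : forall c, ~ dom c base -> comp c = 0 ;
  comp_change : forall c d, dom c base -> dom d base ->
    comp d = 'D_(comp c) (transition c d) (phi c base) }.

Lemma tangent_bundle_eq (v w : tangent_bundle) :
  base v = base w -> comp v = comp w -> v = w.
Proof.
case: v w => p y y0 yT [q z z0 zT] /= pq yz; case: _ / pq z0 zT => z0 zT.
by case: _ / yz z0 zT => z0 zT; congr TangentVector; exact: Prop_irrelevance.
Qed.

Lemma phi_invK c p : dom c p -> phi_inv c (phi c p) = p.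
Proof. exact: cmapK. Qed.

Lemma phiK c x : codom_chart c x -> phi c (phi_inv c x) = x.
Proof. by case=> p cp <-; rewrite phi_invK. Qed.

Lemma dom_phi_inv c x : codom_chart c x -> dom c (phi_inv c x).
Proof. by case=> p cp <-; rewrite phi_invK. Qed.

Lemma transition_differentiable c d p : dom c p -> dom d p ->
  differentiable (transition c d) (phi c p).
Proof.
by move=> cp dp; apply: (@chart_compat _ _ M c d [::]); exists p.
Qed.

Lemma dom_phi_inv_near c d p : dom c p -> dom d p ->
  \forall x \near phi c p, codom_chart c x /\ dom d (phi_inv c x).
Proof.
move=> cp dp; have inv_c : {in codom_chart c, continuous (phi_inv c)}.
  have := @cinv_continuous _ _ _ (chart c).
  by rewrite continuous_open_subspace//; exact: cimg_open.
have nc : nbhs (phi c p) (codom_chart c).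
  by apply: open_nbhs_nbhs; split; [exact: cimg_open|exists p].
have nd : nbhs (phi_inv c (phi c p)) (dom d).
  rewrite phi_invK//; apply: open_nbhs_nbhs; split=> //; exact: cdom_open.
have /inv_c/(_ _ nd) : phi c p \in codom_chart c by rewrite inE; exists p.
by move=> nid; apply: filterI.
Qed.

Lemma derive_transition c d e p (y : 'rV[R]_n) :
    dom c p -> dom d p -> dom e p ->
  'D_('D_y (transition c d) (phi c p)) (transition d e) (phi d p) =
  'D_y (transition c e) (phi c p).
Proof.
move=> cp dp ep.
have phicd : transition c d (phi c p) = phi d p.
  by rewrite /transition/= phi_invK.
have dcd := transition_differentiable cp dp.
have dde := transition_differentiable dp ep.
rewrite -phicd in dde *.
rewrite -(derive_comp_diff _ dcd dde).
apply: near_eq_derive; apply: filterS (dom_phi_inv_near cp dp) => x [cx dx].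
by rewrite /transition/= phi_invK.
Qed.

Lemma derive_transition_id c p (y : 'rV[R]_n) : dom c p ->
  'D_y (transition c c) (phi c p) = y.
Proof.
move=> cp; rewrite -[RHS](derive_id (phi c p)); apply: near_eq_derive.
by apply: filterS (dom_phi_inv_near cp cp) => x [cx _]; exact: phiK.
Qed.

Section FromCoordinates.
Variables (c : atlas M) (x y : 'rV[R]_n) (cx : codom_chart c x).

Let components d : 'rV[R]_n :=
  if `[< dom d (phi_inv c x) >] then 'D_y (transition c d) x else 0.

Let components_out d : ~ dom d (phi_inv c x) -> components d = 0.
Proof. by move=> nd; rewrite /components asboolF. Qed.

Let components_change d e : dom d (phi_inv c x) -> dom e (phi_inv c x) ->
  components e = 'D_(components d) (transition d e) (phi d (phi_inv c x)).
Proof.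
move=> dp ep; rewrite /components (asboolT dp) (asboolT ep).
by have := derive_transition y (dom_phi_inv cx) dp ep; rewrite (phiK cx).
Qed.

Definition tangent_of_coords : tangent_bundle :=
  TangentVector components_out components_change.

End FromCoordinates.

(* Expression of a function on TM in the standard local coordinates (x, y) of
   the chart c; it is set to 0 when x is outside the image of the chart. *)
Definition local_expr (f : tangent_bundle -> R) c
    (z : 'rV[R]_n * 'rV[R]_n) : R :=
  match pselect (codom_chart c z.1) with
  | left cx => f (tangent_of_coords z.2 cx)
  | right _ => 0
  end.

Lemma local_exprE (f : tangent_bundle -> R) c (v : tangent_bundle) :
  dom c (base v) -> local_expr f c (phi c (base v), comp v c) = f v.
Proof.
move=> cv; rewrite /local_expr; case: pselect => [cx|]; last first.
  by move=> /=; case; exists (base v).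
congr f; have bE := phi_invK cv; apply: tangent_bundle_eq => //.
apply/funext => d /=; rewrite bE; case: asboolP => [dv|/comp_out//].
by rewrite (comp_change cv dv).
Qed.

Definition slit c : set ('rV[R]_n * 'rV[R]_n) :=
  [set z | codom_chart c z.1 /\ z.2 != 0].

End TangentBundle.

(* Local coordinate expressions.  The arguments F, A below are functions of
   z = (x, y), with x = z.1 and y = z.2. *)
Section LocalFinsler.
Context {R : realType} {n : nat}.
Local Notation local_fun := ('rV[R]_n * 'rV[R]_n -> R).
Implicit Types (F A f : local_fun) (z : 'rV[R]_n * 'rV[R]_n) (i j k p q : 'I_n).

Definition dx i f : local_fun := fun z => 'D_(delta_mx ord0 i, 0) f z.
Definition dy i f : local_fun := fun z => 'D_(0, delta_mx ord0 i) f z.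
Definition yc i : local_fun := fun z => z.2 ord0 i.

Definition pos_def (B : 'M[R]_n) : Prop :=
  forall v : 'rV[R]_n, v != 0 -> 0 < (v *m B *m v^T) ord0 ord0.

Definition hess_y f z : 'M[R]_n := \matrix_(i, j) dy i (dy j f) z.

Definition metric F z : 'M[R]_n := 2^-1 *: hess_y (fun w => F w ^+ 2) z.
Definition g_low F i j : local_fun := fun z => metric F z i j.
Definition g_up F i j : local_fun := fun z => invmx (metric F z) i j.
Definition y_low F i : local_fun := fun z => \sum_j g_low F i j z * yc j z.

Definition angular F i j : local_fun :=
  fun z => g_low F i j z - (F z) ^- 2 * y_low F i z * y_low F j z.

Definition spray F i : local_fun := fun z =>
  4^-1 * \sum_k g_up F i k z *
    \sum_p \sum_q (2 * dx q (g_low F p k) z - dx k (g_low F p q) z)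
                    * yc p z * yc q z.

Definition mean_berwald F i j : local_fun := fun z =>
  2^-1 * \sum_k dy i (dy j (dy k (spray F k))) z.

Definition H_curvature F i j : local_fun := fun z =>
  \sum_k yc k z * dx k (mean_berwald F i j) z
  - \sum_k 2 * spray F k z * dy k (mean_berwald F i j) z
  - \sum_k dy i (spray F k) z * mean_berwald F k j z
  - \sum_k dy j (spray F k) z * mean_berwald F i k z.

End LocalFinsler.

Section Finsler.
Context {R : realType} {n : nat} {M : manifold R n}.
Implicit Types (F A theta : tangent_bundle M -> R).

Record finsler_metric F : Prop := FinslerMetric {
  finsler_ge0 : forall v, 0 <= F v ;
  finsler_smooth : forall c : atlas M, smooth_on (slit c) (local_expr F c) ;
  finsler_homogeneous : forall (c : atlas M) x y (l : R),
    codom_chart c x -> 0 < l ->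
    local_expr F c (x, l *: y) = l * local_expr F c (x, y) ;
  finsler_pos_def : forall (c : atlas M) z,
    slit c z -> pos_def (metric (local_expr F c) z) }.

(* In each chart A = a_{i_1 ... i_m}(x) y^{i_1} ... y^{i_m}, where the
   multi-index (i_1, ..., i_m) is the function I. *)
Definition homogeneous_form (m : nat) A : Prop :=
  forall c : atlas M, exists a : {ffun 'I_m -> 'I_n} -> 'rV[R]_n -> R,
    (forall (s : 'S_m) (I : {ffun 'I_m -> 'I_n}) x, codom_chart c x ->
       a [ffun k => I (s k)] x = a I x) /\
    (forall x y, codom_chart c x ->
      local_expr A c (x, y) = \sum_I a I x * \prod_k y ord0 (I k)).

(* [powR] is only the m-th root on nonnegative reals; A cannot be negative
   anywhere because [powR] would then be 1 along a whole ray, contradicting the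
   homogeneity of F. *)
Definition mth_root_finsler_metric (m : nat) F : Prop :=
  finsler_metric F /\
  exists A, [/\ homogeneous_form m A,
    forall v, F v = A v `^ m%:R^-1 &
    forall (c : atlas M) z, slit c z -> pos_def (hess_y (local_expr A c) z)].

Definition one_form theta : Prop :=
  forall c : atlas M, exists t : 'I_n -> 'rV[R]_n -> R,
    (forall i, smooth_on (codom_chart c) (t i)) /\
    (forall x y, codom_chart c x ->
      local_expr theta c (x, y) = \sum_i t i x * y ord0 i).

Definition isotropic_H_curvature F : Prop :=
  exists theta, one_form theta /\
    forall (c : atlas M) z, slit c z -> forall i j,
      H_curvature (local_expr F c) i j z =
      n.+1%:R / (2 * local_expr F c z) * local_expr theta c z
        * angular (local_expr F c) i j z.

Definition vanishing_H_curvature F : Prop :=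
  forall (c : atlas M) z, slit c z -> forall i j,
    H_curvature (local_expr F c) i j z = 0.

End Finsler.

(* Main.v *)
Require Import Defs.
From mathcomp Require Import all_boot all_order all_algebra.
From mathcomp Require Import all_classical all_reals all_analysis.
Import Order.TTheory GRing.Theory Num.Theory.
Import numFieldNormedType.Exports.
Local Open Scope classical_set_scope.
Local Open Scope ring_scope.

(** Reflecting the fibres, (x, y) |-> (x, -y), decides the matter.  The form A
    of degree m has the parity of m in y.  If m were odd, the Hessian of A would
    change sign under the reflection, which is impossible for a matrix that is
    positive definite at both (x, y) and (x, -y).  So m is even and F is
    reversible: F(x, -y) = F(x, y) ([mth_root_even]).

    Each derivative in y reverses parity and each derivative in x keeps it
    ([parity_dy], [parity_dx]).  For a reversible F the metric, the angular
    metric and the spray coefficients are therefore even in y, the mean Berwald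
    curvature (three y-derivatives of the spray) is odd, and the H-curvature is
    even ([parity_H_curvature]).  On the other hand
    (n + 1) / (2 F) * theta * h_ij is odd, because theta is linear in y while F
    and h_ij are even.  A quantity that is both even and odd vanishes. *)

(** * Parity in the fibre variable *)

Section Parity.
Context {R : realType} {n : nat}.
Local Notation point := ('rV[R]_n * 'rV[R]_n)%type.
Implicit Types (f g F : point -> R) (z v : point) (b : bool) (i j k : 'I_n).

Definition fibre_opp z : point := (z.1, - z.2).

(** The sign is indexed by a boolean, [true] meaning odd, so that parities of
    products add up as booleans. *)
Definition parity b f := forall z, f (fibre_opp z) = (-1) ^+ b * f z.

(** When the limit does not exist both sides are the default value 0.  So
    parities pass to derivatives without any regularity assumption, and the
    smoothness of F never has to be propagated through the curvatures. *)
Lemma lim_signM (T : Type) (G : set_system T) {FG : ProperFilter G}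
    (u : T -> R) b :
  lim ((-1) ^+ b * u x @[x --> G]) = (-1) ^+ b * lim (u x @[x --> G]).
Proof.
have sK (w : T -> R) : (fun x => (-1) ^+ b * ((-1) ^+ b * w x)) = w.
  by apply/funext => x; rewrite mulrA -expr2 sqrr_sign mul1r.
have [cu|ncu] := pselect (cvg (u x @[x --> G])).
  apply: cvg_lim; first exact: Rhausdorff; exact: (cvgM (cvg_cst _) cu).
have ncsu : ~ cvg ((-1) ^+ b * u x @[x --> G]).
  move=> csu; apply: ncu; rewrite -(sK u).
  exact: (is_cvgM (is_cvg_cst _) csu).
by rewrite (dvgP ncu) (dvgP ncsu) mulr0.
Qed.

Lemma derive_signM f b v z :
  'D_v (fun w => (-1) ^+ b * f w) z = (-1) ^+ b * 'D_v f z.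
Proof.
rewrite /derive -lim_signM; congr (lim _); apply: (congr1 (fmap^~ _)).
apply/funext => h /=.
by rewrite -mulrBr /GRing.scale /= mulrCA.
Qed.

Lemma dnbhs0_opp : -%R @ (0 : R)^' = (0 : R)^'.
Proof.
have oppW B : (0 : R)^' B -> (0 : R)^' (-%R @^-1` B).
  case=> e /= e0 eB; exists e => //= x /=; rewrite sub0r normrN => xe x0.
  by apply: eB; rewrite /= ?oppr_eq0 ?sub0r ?opprK.
apply/seteqP; split=> B; last exact: oppW.
by move=> /oppW; congr (_ ^'); apply/funext => x /=; rewrite opprK.
Qed.

(** Reversing the direction amounts to the substitution h |-> -h in the
    difference quotient; this holds even when the derivative does not exist. *)
Lemma derive_opp_dir f v z : 'D_(- v) f z = - 'D_v f z.
Proof.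
rewrite -mulN1r -[-1]expr1 /derive -(lim_signM _ _ _ true) -[in RHS]dnbhs0_opp.
rewrite -fmap_comp; congr (lim _); apply: (congr1 (fmap^~ _)).
apply/funext => h /=.
by rewrite expr1 mulN1r invrN scaleNr opprK scalerN scaleNr.
Qed.

Lemma derive_fibre_opp f v z :
  'D_v f (fibre_opp z) = 'D_(fibre_opp v) (f \o fibre_opp) z.
Proof.
rewrite /derive; congr (lim _); apply: (congr1 (fmap^~ _)).
apply/funext => h /=.
by rewrite /fibre_opp /= opprD scalerN opprK.
Qed.

Lemma derive_parity b f v z : parity b f ->
  'D_v f (fibre_opp z) = (-1) ^+ b * 'D_(fibre_opp v) f z.
Proof.
move=> pf; rewrite derive_fibre_opp -derive_signM; congr ('D__ _ _).
exact/funext.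
Qed.

Lemma parity_dx b f i : parity b f -> parity b (dx i f).
Proof.
by move=> pf z; rewrite /dx (derive_parity _ _ _ _ pf) /fibre_opp /= oppr0.
Qed.

Lemma parity_dy b f i : parity b f -> parity (~~ b) (dy i f).
Proof.
move=> pf z; rewrite /dy (derive_parity _ _ _ _ pf).
have -> : fibre_opp (0, delta_mx ord0 i) = - (0, delta_mx ord0 i) :> point.
  by rewrite /fibre_opp /= -[RHS]/(- 0, _) oppr0.
by rewrite derive_opp_dir signrN mulrN mulNr.
Qed.

Lemma parity_yc i : parity true (yc i).
Proof. by move=> z; rewrite /yc /= !mxE expr1 mulN1r. Qed.

Lemma parityM a b f g :
  parity a f -> parity b g -> parity (a (+) b) (fun z => f z * g z).
Proof. by move=> pf pg z; rewrite pf pg signr_addb mulrACA. Qed.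

Lemma parity_scale b (r : R) f : parity b f -> parity b (fun z => r * f z).
Proof. by move=> pf z; rewrite pf mulrCA. Qed.

Lemma parityB b f g : parity b f -> parity b g -> parity b (fun z => f z - g z).
Proof. by move=> pf pg z; rewrite pf pg -mulrBr. Qed.

Lemma parity_sum (I : finType) b (f : I -> point -> R) :
  (forall k : I, parity b (f k)) -> parity b (fun z => \sum_k f k z).
Proof.
by move=> pf z; rewrite mulr_sumr; apply: eq_bigr => k _; exact: pf.
Qed.

Lemma parity_hess_y b f i j : parity b f -> parity b (fun z => hess_y f z i j).
Proof.
move=> pf z; rewrite !mxE -[b in RHS]negbK.
exact: (parity_dy _ _ i (parity_dy _ _ j pf)).
Qed.

(** * Reversible metrics *)

Section Reversible.
Variable F : point -> R.
Hypothesis F_even : parity false F.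

Lemma parity_g_low i j : parity false (g_low F i j).
Proof.
have F2 : parity false (fun w => F w ^+ 2).
  by move=> z; rewrite F_even !mul1r.
move=> z; have := parity_scale _ 2^-1 _ (parity_hess_y _ _ i j F2) z.
by rewrite /g_low !mxE.
Qed.

Lemma metric_fibre_opp z : metric F (fibre_opp z) = metric F z.
Proof. by apply/matrixP => i j; have := parity_g_low i j z; rewrite mul1r. Qed.

Lemma parity_g_up i j : parity false (g_up F i j).
Proof. by move=> z; rewrite /g_up metric_fibre_opp mul1r. Qed.

Lemma parity_y_low i : parity true (y_low F i).
Proof.
apply: parity_sum => j; exact: parityM (parity_g_low i j) (parity_yc j).
Qed.

Lemma parity_angular i j : parity false (angular F i j).
Proof.
apply: parityB; first exact: parity_g_low.
apply: (parityM true true); last exact: parity_y_low.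
apply: (parityM false true); last exact: parity_y_low.
by move=> z; rewrite F_even !mul1r.
Qed.

Lemma parity_spray i : parity false (spray F i).
Proof.
apply: parity_scale; apply: parity_sum => k.
apply: (parityM false false); first exact: parity_g_up.
apply: parity_sum => p; apply: parity_sum => q.
apply: (parityM true true); last exact: parity_yc.
apply: (parityM false true); last exact: parity_yc.
by apply: parityB; [apply: parity_scale|]; apply: parity_dx; exact: parity_g_low.
Qed.

Lemma parity_mean_berwald i j : parity true (mean_berwald F i j).
Proof.
apply: parity_scale; apply: parity_sum => k.
apply: (parity_dy false); apply: (parity_dy true); apply: (parity_dy false).
exact: parity_spray.
Qed.

Lemma parity_H_curvature i j : parity false (H_curvature F i j).
Proof.
have dyG k l : parity true (dy k (spray F l)).
  exact: (parity_dy false) (parity_spray l).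
apply: parityB; [apply: parityB; [apply: parityB|]|]; apply: parity_sum => k.
- apply: (parityM true true); first exact: parity_yc.
  by apply: parity_dx; exact: parity_mean_berwald.
- apply: (parityM false false).
    by apply: parity_scale; exact: parity_spray.
  exact: (parity_dy true) (parity_mean_berwald i j).
- exact: (parityM true true) (dyG i k) (parity_mean_berwald k j).
- exact: (parityM true true) (dyG j k) (parity_mean_berwald i k).
Qed.

End Reversible.
End Parity.

(** * Forms and metrics on the tangent bundle *)

Section Bundle.
Context {R : realType} {n : nat} {M : manifold R n}.
Implicit Types (F A theta : tangent_bundle M -> R) (c : atlas M).

(** Outside the image of the chart the local expression is 0 at both points. *)
Lemma local_parity A c (b : bool) :
    (forall x y, codom_chart c x ->
       local_expr A c (x, - y) = (-1) ^+ b * local_expr A c (x, y)) ->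
  parity b (local_expr A c).
Proof.
move=> pA [x y]; have [cx|ncx] := pselect (codom_chart c x); first exact: pA.
by rewrite /local_expr; case: pselect => // _; rewrite mulr0.
Qed.

Lemma parity_homogeneous_form {m A} c : homogeneous_form m A ->
  parity (odd m) (local_expr A c).
Proof.
move=> /(_ c)[a [_ aE]]; apply: local_parity => x y cx.
rewrite !aE// mulr_sumr; apply: eq_bigr => I _.
under eq_bigr do rewrite mxE -mulN1r.
by rewrite big_split /= prodr_const card_ord signr_odd mulrCA.
Qed.

Lemma parity_one_form {theta} c :
  one_form theta -> parity true (local_expr theta c).
Proof.
move=> /(_ c)[t [_ tE]]; apply: local_parity => x y cx.
by rewrite !tE// mulr_sumr; apply: eq_bigr => i _; rewrite mxE mulrN mulN1r.
Qed.

Lemma slit_fibre_opp c z : slit c z -> slit c (fibre_opp z).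
Proof. by case=> cz z0; split=> //=; rewrite oppr_eq0. Qed.

(** The Hessian of an odd function is odd, so it cannot be positive definite at
    two opposite vectors. *)
Lemma pos_def_hess_even c b A z : slit c z -> parity b (local_expr A c) ->
  (forall w, slit c w -> pos_def (hess_y (local_expr A c) w)) -> b = false.
Proof.
case: b => // cz pA posA.
have := posA _ (slit_fibre_opp _ _ cz) _ (proj2 cz).
have -> : hess_y (local_expr A c) (fibre_opp z) = - hess_y (local_expr A c) z.
  apply/matrixP => i j; rewrite (parity_hess_y _ _ _ _ pA) [in RHS]mxE.
  by rewrite expr1 mulN1r.
rewrite mulmxN mulNmx mxE oppr_gt0 => neg.
by have := lt_trans neg (posA _ cz _ (proj2 cz)); rewrite ltxx.
Qed.

Lemma mth_root_even m F c z : slit c z -> mth_root_finsler_metric m F ->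
  parity false (local_expr F c).
Proof.
move=> cz [_ [A [formA FA posA]]].
have pA := parity_homogeneous_form c formA.
have even_m := pos_def_hess_even _ _ _ _ cz pA (posA c); rewrite even_m in pA.
apply: local_parity => x y cx.
have FAc w : codom_chart c w.1 ->
    local_expr F c w = local_expr A c w `^ m%:R^-1.
  by rewrite /local_expr; case: pselect => // cw _; rewrite FA.
by rewrite !FAc// (pA (x, y)) !mul1r.
Qed.

End Bundle.

Theorem theorem2 (R : realType) (n m : nat) (M : manifold R n)
    (F : tangent_bundle M -> R) :
  (2 <= n)%N -> (0 < m)%N ->
  mth_root_finsler_metric m F ->
  isotropic_H_curvature F ->
  vanishing_H_curvature F.
Proof.
move=> _ _ rootF [theta [formtheta HE]] c z cz i j.
have evenF := mth_root_even _ _ _ _ cz rootF.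
have evenH := parity_H_curvature _ evenF i j z.
have oddH : H_curvature (local_expr F c) i j (fibre_opp z) =
    - H_curvature (local_expr F c) i j z.
  rewrite (HE _ _ (slit_fibre_opp _ _ cz)) (HE _ _ cz).
  rewrite evenF (parity_one_form c formtheta) (parity_angular _ evenF).
  by rewrite expr0 expr1 !mul1r mulN1r mulrN mulNr.
by apply/eqP; rewrite -eqNr -oddH evenH mul1r.
Qed.
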